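(* Suppose $u(x,t)$ is a real-valued solution of the generalized sine-Gordon equation $$u_{tx}=(1-\partial_x^2)\sin(u),\qquad x\in\mathbb{R},\ t>0,$$ which is sufficiently smooth and such that $\cos(u(x,t))-1$ has sufficient decay as $x\to\pm\infty$ for each $t$. Then the function $Q(y,\tau)$ defined by $$Q(y,\tau)=-u(x,t)-\arcsin\left(\frac{u_x(x,t)}{\sqrt{1+u_x^2(x,t)}}\right),$$ $$y=x-t+\int_{-\infty}^x\left(\sqrt{1+u_x^2(x',t)}-1\right)dx',\qquad \tau=t,$$ satisfies the sine-Gordon equation $$Q_{\tau y}=\sin(Q).$$
   Context: Subscripts denote partial derivatives. ''Sufficient smoothness and decay'' means that $u$ is regular enough for all derivatives used to exist and be continuous, that $u(x,t)\to 2\pi n$ for some $n\in\mathbb{Z}$ and $u_x(x,t)\to0$ as $x\to-\infty$, and that the integral defining $y$ converges and may be differentiated in $x$ and $t$ (the $t$-derivative being taken under the integral sign). Since $y_x=\sqrt{1+u_x^2}\ge 1$, the map $(x,t)\mapsto(y,\tau)$ is an invertible change of variables. *)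

(* Defs.v *)
From Stdlib Require Import Reals.
From Coquelicot Require Import Coquelicot.

Open Scope R_scope.

(* Functions of two variables are curried, space-like variable first, so that
   [dx (dt f)] is f_{tx}: subscripts are applied from left to right. *)
Definition dx (f : R -> R -> R) (x t : R) : R := Derive (fun z => f z t) x.
Definition dt (f : R -> R -> R) (x t : R) : R := Derive (fun s => f x s) t.

(* Being local, derivatives at [t > 0] do not see the values of [f] at
   nonpositive times; [Derive] is total, so existence is always stated. *)
Definition has_dx (f : R -> R -> R) : Prop :=
  forall x t, 0 < t -> ex_derive (fun z => f z t) x.
Definition has_dt (f : R -> R -> R) : Prop :=
  forall x t, 0 < t -> ex_derive (fun s => f x s) t.
Definition continuous_half_plane (f : R -> R -> R) : Prop :=
  forall x t, 0 < t -> continuity_2d_pt f x t.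

Definition gen_sine_Gordon (u : R -> R -> R) : Prop :=
  forall x t, 0 < t ->
    dx (dt u) x t
    = sin (u x t) - dx (dx (fun x' t' => sin (u x' t'))) x t.

Definition sine_Gordon (Q : R -> R -> R) : Prop :=
  has_dt Q /\ has_dx (dt Q) /\
  forall y tau, 0 < tau -> dx (dt Q) y tau = sin (Q y tau).

Definition arc_excess (u : R -> R -> R) (x t : R) : R :=
  sqrt (1 + (dx u x t) ^ 2) - 1.

Definition tail_integral (f : R -> R -> R) (x t : R) : R :=
  RInt_gen (fun x' => f x' t) (Rbar_locally m_infty) (at_point x).
Definition tail_integral_converges (f : R -> R -> R) : Prop :=
  forall x t, 0 < t ->
    ex_RInt_gen (fun x' => f x' t) (Rbar_locally m_infty) (at_point x).

Definition y_coord (u : R -> R -> R) (x t : R) : R :=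
  x - t + tail_integral (arc_excess u) x t.

(* u, u_x, u_t, u_xx, u_tx and u_xt are the derivatives that occur in the two
   equations and in the t-derivative of the integral. *)
Definition sufficiently_smooth (u : R -> R -> R) : Prop :=
  (has_dx u /\ has_dt u /\ has_dx (dx u) /\ has_dx (dt u) /\ has_dt (dx u)) /\
  (continuous_half_plane u /\
   continuous_half_plane (dx u) /\
   continuous_half_plane (dt u) /\
   continuous_half_plane (dx (dx u)) /\
   continuous_half_plane (dx (dt u)) /\
   continuous_half_plane (dt (dx u))).

Definition sufficient_decay (u : R -> R -> R) : Prop :=
  (forall t, 0 < t ->
     exists n : Z, is_lim (fun x => u x t) m_infty (2 * PI * IZR n)) /\
  (forall t, 0 < t -> is_lim (fun x => dx u x t) m_infty 0) /\
  tail_integral_converges (arc_excess u) /\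
  has_dx (tail_integral (arc_excess u)) /\
  tail_integral_converges (dt (arc_excess u)) /\
  (forall x t, 0 < t ->
     is_derive (fun s => tail_integral (arc_excess u) x s) t
               (tail_integral (dt (arc_excess u)) x t)).

(* Main.v *)
(* Write p = u_x and s = sqrt (1 + p^2), so that asin (p / s) = atan p.  The
   equation reads p_t = s^2 sin u - p_x cos u, and it yields the conservation
   law s_t = - (s cos u)_x; integrating from -oo, where s cos u -> 1, gives
   y_t = - s cos u, while y_x = s.  Hence the level curves x = X(y, t) of y
   satisfy X_y = 1 / s and X_t = cos u.  Along them the terms in p_x cancel:
   Q_t = - u_t - sin u - p cos u.  Its x-derivative divided by s is
   - (sin u + p cos u) / s = - sin (u + atan p) = sin Q. *)

Require Import Defs.
From Stdlib Require Import Reals Lra.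
From Coquelicot Require Import Coquelicot.

Open Scope R_scope.

(** * Elementary identities for atan, cos and the square root of 1 + p^2 *)

Lemma asin_slope (p : R) : asin (p / sqrt (1 + p ^ 2)) = atan p.
Proof.
  rewrite <- Rsqr_pow2, <- sin_atan.
  apply asin_sin. generalize (atan_bound p); lra.
Qed.

Lemma cos_2PI_IZR (n : Z) : cos (2 * PI * IZR n) = 1.
Proof.
  (* Natural multiples follow from periodicity; negative [n] reduce to them because cos is even. *)
  assert (H : forall k : nat, cos (2 * PI * INR k) = 1).
  { intros k. replace (2 * PI * INR k) with (0 + 2 * INR k * PI) by ring.
    now rewrite cos_period, cos_0. }
  destruct n as [|p|p].
  - now rewrite Rmult_0_r, cos_0.
  - change (IZR (Z.pos p)) with (IPR p). rewrite <- INR_IPR. apply H.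
  - change (IZR (Z.neg p)) with (- IPR p).
    rewrite <- INR_IPR, Ropp_mult_distr_r_reverse, cos_neg. apply H.
Qed.

Lemma sqrt_1_sqr_ge_1 (p : R) : 1 <= sqrt (1 + p ^ 2).
Proof.
  rewrite <- sqrt_1 at 1. apply sqrt_le_1_alt.
  generalize (pow2_ge_0 p); lra.
Qed.

Lemma sqr_sqrt_1_sqr (p : R) : sqrt (1 + p ^ 2) ^ 2 = 1 + p ^ 2.
Proof. apply pow2_sqrt. generalize (pow2_ge_0 p); lra. Qed.

Lemma is_derive_sqrt_1_sqr (f : R -> R) (x l : R) :
  is_derive f x l ->
  is_derive (fun z => sqrt (1 + f z ^ 2)) x (f x * l / sqrt (1 + f x ^ 2)).
Proof.
  intros H. generalize (sqrt_1_sqr_ge_1 (f x)); intros Hs.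
  assert (Hp := pow2_ge_0 (f x)).
  auto_derive.
  - split; [now exists l | split; [lra | easy]].
  - replace (Derive _ x) with l by (symmetry; now apply is_derive_unique).
    simpl in *. field. lra.
Qed.

Lemma continuous_sqrt_1_sqr (f : R -> R) (x : R) :
  continuous f x -> continuous (fun z => sqrt (1 + f z ^ 2)) x.
Proof.
  intros H. apply (continuous_comp f (fun p => sqrt (1 + p ^ 2)) x H).
  apply (ex_derive_continuous (fun p => sqrt (1 + p ^ 2))).
  eexists. apply is_derive_sqrt_1_sqr. apply (is_derive_id (f x)).
Qed.

(** * Calculus on the half-plane and slopes of level curves *)

Lemma continuous_slice_x (f : R -> R -> R) (x t : R) :
  continuity_2d_pt f x t -> continuous (fun z => f z t) x.
Proof.
  intros H. apply filterlim_locally. intros eps.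
  destruct (H eps) as [d Hd]. exists d. intros z Hz.
  apply Hd; [exact Hz|]. rewrite Rminus_diag, Rabs_R0. apply cond_pos.
Qed.

Lemma locally_gt_0 (t : R) : 0 < t -> locally t (fun s => 0 < s).
Proof. intros Ht. exact (open_gt 0 t Ht). Qed.

Lemma locally_2d_gt_0 (x t : R) (P : R -> R -> Prop) :
  0 < t -> (forall z s, 0 < s -> P z s) -> locally_2d P x t.
Proof.
  intros Ht H. exists (mkposreal t Ht). simpl. intros z s _ Hs.
  apply H. apply Rabs_def2 in Hs. lra.
Qed.

(* If [F (., t)] expands distances, then a level curve [x = g t] of [F] is
   Lipschitz wherever [F] is differentiable, so its slope can be read off the
   first-order expansion of [F]. *)
Lemma implicit_is_derive (F : R -> R -> R) (g : R -> R) (t a b : R) :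
  differentiable_pt_lim F (g t) t a b ->
  0 < a ->
  locally t (fun s => forall x x', Rabs (x - x') <= Rabs (F x s - F x' s)) ->
  locally t (fun s => F (g s) s = F (g t) t) ->
  is_derive g t (- b / a).
Proof.
  intros HF Ha [d1 Hexp] [d2 Hlev].
  (* The Lipschitz constant of [g] at [t]: with tolerance 1, the expansion of [F] along the vertical
     segment at [g t] gives |F (g t) s - F (g t) t| <= (|b| + 1) |s - t|. Constancy of [F] on the
     curve and the expansion of distances turn this into a bound on |g s - g t|. *)
  set (K := Rabs b + 1).
  assert (HK : 1 <= K) by (unfold K; generalize (Rabs_pos b); lra).
  assert (Hlip : exists d : posreal, forall s, Rabs (s - t) < d ->
            Rabs (g s - g t) <= K * Rabs (s - t)).
  { destruct (HF (mkposreal 1 Rlt_0_1)) as [d3 Hd3]. simpl in Hd3.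
    exists (mkposreal _ (Rmin_pos _ _ (cond_pos d3)
             (Rmin_pos _ _ (cond_pos d1) (cond_pos d2)))).
    simpl. intros s Hs.
    assert (H3 : Rabs (s - t) < d3)
      by (eapply Rlt_le_trans; [exact Hs|apply Rmin_l]).
    assert (H12 : Rabs (s - t) < Rmin d1 d2)
      by (eapply Rlt_le_trans; [exact Hs|apply Rmin_r]).
    assert (H1 : Rabs (s - t) < d1)
      by (eapply Rlt_le_trans; [exact H12|apply Rmin_l]).
    assert (H2 : Rabs (s - t) < d2)
      by (eapply Rlt_le_trans; [exact H12|apply Rmin_r]).
    eapply Rle_trans; [apply (Hexp s H1)|].
    rewrite (Hlev s H2), Rabs_minus_sym.
    assert (H0 : Rabs (g t - g t) < d3)
      by (rewrite Rminus_diag, Rabs_R0; apply cond_pos).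
    specialize (Hd3 (g t) s H0 H3).
    rewrite Rminus_diag, Rabs_R0, Rmax_right in Hd3 by apply Rabs_pos.
    replace (F (g t) s - F (g t) t) with
      ((F (g t) s - F (g t) t - (a * 0 + b * (s - t))) + b * (s - t)) by ring.
    eapply Rle_trans; [apply Rabs_triang|].
    rewrite Rabs_mult. unfold K. lra. }
  destruct Hlip as [d4 Hlip].
  apply is_derive_Reals, (differentiable_pt_lim_proj1_1 g t 0).
  intros eps.
  (* Both increments are at most K |s - t|, so this tolerance makes the error in the expansion at
     most a * eps * |s - t|; dividing by [a] leaves eps. *)
  assert (He : 0 < eps * a / K).
  { apply Rdiv_lt_0_compat; [|lra].
    apply Rmult_lt_0_compat; [apply cond_pos|exact Ha]. }
  destruct (HF (mkposreal _ He)) as [d3 Hd3]. simpl in Hd3.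
  (* Within this radius the Lipschitz bound keeps [g s] in the d3-neighbourhood of [g t]. *)
  assert (HdK : 0 < d3 / K)
    by (apply Rdiv_lt_0_compat; [apply cond_pos|lra]).
  exists (mkposreal _ (Rmin_pos _ _ HdK
             (Rmin_pos _ _ (cond_pos d4) (cond_pos d2)))).
  simpl. intros s v Hs _.
  assert (H3 : Rabs (s - t) < d3 / K)
    by (eapply Rlt_le_trans; [exact Hs|apply Rmin_l]).
  assert (H12 : Rabs (s - t) < Rmin d4 d2)
    by (eapply Rlt_le_trans; [exact Hs|apply Rmin_r]).
  assert (H4 : Rabs (s - t) < d4)
    by (eapply Rlt_le_trans; [exact H12|apply Rmin_l]).
  assert (H2 : Rabs (s - t) < d2)
    by (eapply Rlt_le_trans; [exact H12|apply Rmin_r]).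
  specialize (Hlip s H4). specialize (Hlev s H2).
  assert (HKs : K * Rabs (s - t) < d3).
  { apply Rmult_lt_compat_l with (r := K) in H3; [|lra].
    replace (K * (d3 / K)) with (pos d3) in H3 by (field; lra). exact H3. }
  assert (HsK : Rabs (s - t) <= K * Rabs (s - t)).
  { rewrite <- (Rmult_1_l (Rabs (s - t))) at 1.
    apply Rmult_le_compat_r; [apply Rabs_pos|exact HK]. }
  assert (Hd := Hd3 (g s) s ltac:(lra) ltac:(lra)).
  rewrite Hlev, Rminus_diag in Hd.
  replace (0 - (a * (g s - g t) + b * (s - t)))
    with (- (a * (g s - g t) + b * (s - t))) in Hd by ring.
  rewrite Rabs_Ropp in Hd.
  assert (Hm : Rmax (Rabs (g s - g t)) (Rabs (s - t)) <= K * Rabs (s - t))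
    by (apply Rmax_lub; assumption).
  apply Rle_trans with (eps * Rabs (s - t)).
  2:{ apply Rmult_le_compat_l; [apply Rlt_le, cond_pos|apply Rmax_l]. }
  apply Rmult_le_reg_l with a; [exact Ha|].
  rewrite <- (Rabs_pos_eq a) at 1 by lra. rewrite <- Rabs_mult.
  replace (a * (g s - g t - (- b / a * (s - t) + 0 * (v - 0))))
    with (a * (g s - g t) + b * (s - t)) by (field; lra).
  eapply Rle_trans; [exact Hd|].
  apply Rmult_le_compat_l with (r := eps * a / K) in Hm; [|lra].
  replace (eps * a / K * (K * Rabs (s - t))) with (a * (eps * Rabs (s - t)))
    in Hm by (field; lra).
  exact Hm.
Qed.

(** Continuity of the x-derivative controls x-increments uniformly at nearby times, and the
    t-derivative at the single point accounts for the remaining increment. *)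
Lemma half_plane_differentiable (F Fx : R -> R -> R) (x t Ft : R) :
  0 < t ->
  (forall z s, 0 < s -> is_derive (fun w => F w s) z (Fx z s)) ->
  is_derive (fun s => F x s) t Ft ->
  continuity_2d_pt Fx x t ->
  differentiable_pt_lim F x t (Fx x t) Ft.
Proof.
  intros Ht Hx Htt Hc.
  apply filterdiff_differentiable_pt_lim.
  apply (is_derive_filterdiff F x t Fx Ft).
  - apply (proj1 (locally_2d_locally
      (fun z s => is_derive (fun w => F w s) z (Fx z s)) x t)).
    now apply locally_2d_gt_0.
  - exact Htt.
  - apply continuity_2d_pt_filterlim. exact Hc.
Qed.

Lemma continuity_2d_comp (f : R -> R) (g : R -> R -> R) (x t : R) :
  (forall p, continuous f p) ->
  continuity_2d_pt g x t -> continuity_2d_pt (fun z s => f (g z s)) x t.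
Proof.
  intros Hf Hg. apply continuity_1d_2d_pt_comp; [|exact Hg].
  apply continuity_pt_filterlim, Hf.
Qed.

(** * The density s = y_x and its conservation law *)

Definition slope (u : R -> R -> R) (x t : R) : R := sqrt (1 + dx u x t ^ 2).

Lemma slope_ge_1 (u : R -> R -> R) (x t : R) : 1 <= slope u x t.
Proof. apply sqrt_1_sqr_ge_1. Qed.

Lemma slope_sqr (u : R -> R -> R) (x t : R) :
  slope u x t ^ 2 = 1 + dx u x t ^ 2.
Proof. apply sqr_sqrt_1_sqr. Qed.

Lemma continuity_2d_slope (u : R -> R -> R) (x t : R) :
  continuity_2d_pt (dx u) x t -> continuity_2d_pt (slope u) x t.
Proof.
  apply (continuity_2d_comp (fun p => sqrt (1 + p ^ 2)) (dx u)).
  intros p. apply (continuous_sqrt_1_sqr (fun q => q)), continuous_id.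
Qed.

(** Schwarz's theorem links u_tx, which the equation prescribes, to u_xt, which arises when s is
    differentiated in t. *)
Lemma dt_dx_comm (u : R -> R -> R) (x t : R) :
  sufficiently_smooth u -> 0 < t -> dt (dx u) x t = dx (dt u) x t.
Proof.
  intros [(h1 & h2 & h3 & h4 & h5) (c1 & c2 & c3 & c4 & c5 & c6)] Ht.
  symmetry. apply (Schwarz u x t).
  - apply locally_2d_gt_0; [exact Ht|]. intros z s Hs.
    repeat split; [apply h1|apply h2|apply (h4 z s)|apply (h5 z s)]; exact Hs.
  - apply (c5 x t Ht).
  - apply (c6 x t Ht).
Qed.

(** Expand (sin u)_xx = p_x cos u - p^2 sin u with p = u_x; the two sine terms combine to (1 + p^2)
    sin u. *)
Lemma dt_dx_eq (u : R -> R -> R) (x t : R) :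
  sufficiently_smooth u -> gen_sine_Gordon u -> 0 < t ->
  dt (dx u) x t
  = slope u x t ^ 2 * sin (u x t) - dx (dx u) x t * cos (u x t).
Proof.
  intros hs hu Ht.
  rewrite dt_dx_comm, (hu x t Ht), slope_sqr by assumption.
  destruct hs as [(h1 & _ & h3 & _) _].
  replace (dx (dx (fun x' t' => sin (u x' t'))) x t)
    with (- dx u x t ^ 2 * sin (u x t) + dx (dx u) x t * cos (u x t)).
  { ring. }
  symmetry. unfold dx at 1.
  rewrite (Derive_ext _ (fun z => dx u z t * cos (u z t))).
  - apply is_derive_unique. auto_derive.
    + repeat split; [apply (h3 x t Ht)|apply (h1 x t Ht)].
    + fold (dx u x t). fold (dx (dx u) x t). unfold dx; simpl; ring.
  - intros z. apply is_derive_unique. auto_derive.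
    + apply (h1 z t Ht).
    + unfold dx; ring.
Qed.

Lemma dt_arc_excess (u : R -> R -> R) (x t : R) :
  has_dt (dx u) -> 0 < t ->
  dt (arc_excess u) x t = dx u x t * dt (dx u) x t / slope u x t.
Proof.
  intros h Ht. apply is_derive_unique.
  replace (dx u x t * dt (dx u) x t / slope u x t)
    with (minus (dx u x t * dt (dx u) x t / slope u x t) 0)
    by (unfold minus, plus, opp; simpl; ring).
  apply (is_derive_minus (fun s => slope u x s) (fun _ => 1)).
  - apply (is_derive_sqrt_1_sqr (fun s => dx u x s)).
    apply Derive_correct, (h x t Ht).
  - apply (is_derive_const (V := R_NormedModule)).
Qed.

(** The conservation law: (- s cos u)_x = s p sin u - p p_x cos u / s = p (s^2 sin u - p_x cos u) /
    s, which is p p_t / s = s_t. *)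
Lemma is_derive_flux (u : R -> R -> R) (x t : R) :
  sufficiently_smooth u -> gen_sine_Gordon u -> 0 < t ->
  is_derive (fun z => - (slope u z t * cos (u z t))) x
            (dt (arc_excess u) x t).
Proof.
  intros hs hu Ht.
  assert (Hs1 := slope_ge_1 u x t).
  assert (Hs2 := slope_sqr u x t).
  assert (hs' := hs).
  destruct hs' as [(h1 & _ & h3 & _ & h5) _].
  rewrite dt_arc_excess, dt_dx_eq by assumption.
  assert (Hsl : is_derive (fun z => slope u z t) x
                  (dx u x t * dx (dx u) x t / slope u x t)).
  { apply (is_derive_sqrt_1_sqr (fun z => dx u z t)).
    apply Derive_correct, (h3 x t Ht). }
  auto_derive.
  - split; [now eexists; exact Hsl|split; [apply (h1 x t Ht)|easy]].
  - replace (Derive (fun z => slope u z t) x)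
      with (dx u x t * dx (dx u) x t / slope u x t)
      by (symmetry; now apply is_derive_unique).
    change (Derive (fun x0 => u x0 t) x) with (dx u x t).
    field. lra.
Qed.

Lemma continuous_dt_arc_excess (u : R -> R -> R) (x t : R) :
  sufficiently_smooth u -> 0 < t ->
  continuous (fun z => dt (arc_excess u) z t) x.
Proof.
  intros [(_ & _ & _ & _ & h5) (_ & c2 & _ & _ & _ & c6)] Ht.
  apply (continuous_ext (fun z => dx u z t * dt (dx u) z t * / slope u z t)).
  { intros z. symmetry. apply (dt_arc_excess u z t h5 Ht). }
  apply (continuous_slice_x
           (fun z s => dx u z s * dt (dx u) z s * / slope u z s)).
  apply continuity_2d_pt_mult.
  - apply continuity_2d_pt_mult; [apply c2|apply c6]; exact Ht.
  - apply continuity_2d_pt_inv.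
    + apply continuity_2d_slope, c2, Ht.
    + generalize (slope_ge_1 u x t); lra.
Qed.

Lemma filterlim_flux (u : R -> R -> R) (t : R) :
  sufficient_decay u -> 0 < t ->
  filterlim (fun z => - (slope u z t * cos (u z t)))
            (Rbar_locally m_infty) (locally (-1)).
Proof.
  intros (d1 & d2 & _) Ht.
  destruct (d1 t Ht) as [n Hn]. specialize (d2 t Ht).
  unfold is_lim in *. simpl in Hn, d2.
  replace (-1) with (- (1 * 1)) by ring.
  apply (filterlim_comp _ _ _ (fun z => slope u z t * cos (u z t)) Ropp
           _ (locally (1 * 1))).
  2:{ apply (filterlim_opp (V := R_NormedModule) (1 * 1)). }
  apply (filterlim_comp_2 (G := locally 1) (H := locally 1)
    (fun z => slope u z t) (fun z => cos (u z t)) Rmult).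
  - assert (H : continuous (fun p => sqrt (1 + p ^ 2)) 0).
    { apply (continuous_sqrt_1_sqr (fun q => q)), continuous_id. }
    unfold continuous in H. simpl in H.
    replace (sqrt (1 + 0 * (0 * 1))) with 1 in H
      by (rewrite Rmult_0_l, Rplus_0_r; symmetry; apply sqrt_1).
    exact (filterlim_comp _ _ _ _ _ _ _ _ d2 H).
  - assert (H := continuous_cos (2 * PI * IZR n)).
    unfold continuous in H. rewrite cos_2PI_IZR in H.
    exact (filterlim_comp _ _ _ _ _ _ _ _ Hn H).
  - apply (filterlim_mult (K := R_AbsRing) 1 1).
Qed.

(** The integrand is the x-derivative of the flux - s cos u, so the fundamental theorem on the
    half-line gives the flux at [x] minus its limit -1. *)
Lemma tail_integral_dt_arc_excess (u : R -> R -> R) (x t : R) :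
  sufficiently_smooth u -> sufficient_decay u -> gen_sine_Gordon u -> 0 < t ->
  tail_integral (dt (arc_excess u)) x t = 1 - slope u x t * cos (u x t).
Proof.
  intros hs hd hu Ht.
  set (f := fun z => - (slope u z t * cos (u z t))).
  assert (Hf : forall z, is_derive f z (dt (arc_excess u) z t))
    by (intros z; now apply is_derive_flux).
  apply is_RInt_gen_unique.
  replace (1 - slope u x t * cos (u x t)) with (f x - (-1))
    by (unfold f; ring).
  assert (Hall : forall P : R * R -> Prop, (forall ab, P ab) ->
            filter_prod (Rbar_locally m_infty) (at_point x) P).
  { intros P HP. apply filter_forall. exact HP. }
  apply (is_RInt_gen_ext (Derive f)).
  { apply Hall. intros ab z _. apply is_derive_unique, Hf. }
  apply is_RInt_gen_Derive.
  - apply Hall. intros ab z _. eexists. apply Hf.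
  - apply Hall. intros ab z _.
    apply (continuous_ext (fun w => dt (arc_excess u) w t)).
    + intros w. symmetry. apply is_derive_unique, Hf.
    + now apply continuous_dt_arc_excess.
  - now apply filterlim_flux.
  - intros P HP. unfold filtermap, at_point. now apply locally_singleton.
Qed.

(** * Partial derivatives of y and growth of y in x *)

Lemma is_derive_y_coord_t (u : R -> R -> R) (x t : R) :
  sufficiently_smooth u -> sufficient_decay u -> gen_sine_Gordon u -> 0 < t ->
  is_derive (fun s => y_coord u x s) t (- (slope u x t * cos (u x t))).
Proof.
  intros hs hd hu Ht.
  (* The -1 is the derivative of the term -t in y; it cancels the 1 left by the flux at minus
     infinity. *)
  replace (- (slope u x t * cos (u x t)))
    with (plus (-1) (tail_integral (dt (arc_excess u)) x t))
    by (rewrite tail_integral_dt_arc_excess by assumption;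
        unfold plus; simpl; ring).
  apply (is_derive_plus (fun s => x - s)
           (fun s => tail_integral (arc_excess u) x s)).
  - auto_derive; [easy|ring].
  - destruct hd as (_ & _ & _ & _ & _ & hd). now apply hd.
Qed.

Lemma continuous_arc_excess (u : R -> R -> R) (x t : R) :
  sufficiently_smooth u -> 0 < t ->
  continuous (fun z => arc_excess u z t) x.
Proof.
  intros [_ (_ & c2 & _)] Ht.
  apply (continuous_slice_x (fun z s => slope u z s - 1)).
  apply continuity_2d_pt_minus.
  - apply continuity_2d_slope, c2, Ht.
  - apply continuity_2d_pt_const.
Qed.

Lemma is_derive_y_coord_x (u : R -> R -> R) (x t : R) :
  sufficiently_smooth u -> sufficient_decay u -> 0 < t ->
  is_derive (fun z => y_coord u z t) x (slope u x t).
Proof.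
  intros hs (_ & _ & hc & _) Ht.
  assert (Hc : forall z, continuous (fun z => arc_excess u z t) z)
    by (intros z; now apply continuous_arc_excess).
  assert (Hex : forall a b, ex_RInt (fun z => arc_excess u z t) a b)
    by (intros a b; apply (ex_RInt_continuous (V := R_CompleteNormedModule));
        intros; apply Hc).
  (* Splitting the improper integral at 0 leaves only a proper integral depending on [z]. *)
  apply (is_derive_ext (fun z => (z - t) +
     (tail_integral (arc_excess u) 0 t + RInt (fun w => arc_excess u w t) 0 z))).
  { intros z. unfold y_coord. f_equal. unfold tail_integral.
    rewrite <- (RInt_gen_at_point _ 0 z) by apply Hex.
    apply (RInt_gen_Chasles (V := R_CompleteNormedModule)).
    - now apply hc.
    - destruct (Hex 0 z) as [l Hl]. exists l. now apply is_RInt_gen_at_point. }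
  replace (slope u x t) with (plus 1 (plus 0 (arc_excess u x t)))
    by (unfold plus, arc_excess, slope; simpl; ring).
  apply (is_derive_plus (fun z => z - t)).
  { auto_derive; [easy|ring]. }
  apply (is_derive_plus (fun _ => tail_integral (arc_excess u) 0 t)).
  - apply (is_derive_const (V := R_NormedModule)).
  - apply (is_derive_RInt (fun w => arc_excess u w t) _ 0 x); [|apply Hc].
    apply filter_forall. intros z.
    apply (RInt_correct (V := R_CompleteNormedModule)), Hex.
Qed.

(** By the mean value theorem, since y_x = s >= 1. This yields both injectivity in x and the
    expansion hypothesis of [implicit_is_derive]. *)
Lemma y_coord_expanding (u : R -> R -> R) (x x' t : R) :
  sufficiently_smooth u -> sufficient_decay u -> 0 < t ->
  Rabs (x - x') <= Rabs (y_coord u x t - y_coord u x' t).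
Proof.
  intros hs hd Ht.
  assert (H : forall z, is_derive (fun z => y_coord u z t) z (slope u z t))
    by (intros z; now apply is_derive_y_coord_x).
  destruct (MVT_gen (fun z => y_coord u z t) x' x (fun z => slope u z t))
    as [c [_ Hc]].
  - intros z _. apply H.
  - intros z _. apply continuity_pt_filterlim.
    apply (ex_derive_continuous (fun z => y_coord u z t)).
    eexists. apply H.
  - rewrite Hc, Rabs_mult.
    rewrite (Rabs_pos_eq (slope u c t))
      by (generalize (slope_ge_1 u c t); lra).
    rewrite <- (Rmult_1_l (Rabs (x - x'))) at 1.
    apply Rmult_le_compat_r; [apply Rabs_pos|apply slope_ge_1].
Qed.

(** * The inverse change of variables x = X(y, t) and its derivatives *)

Lemma y_coord_inverse (u : R -> R -> R) :
  sufficiently_smooth u -> sufficient_decay u ->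
  exists X : R -> R -> R, forall y t, 0 < t -> y_coord u (X y t) t = y.
Proof.
  intros hs hd.
  (* A preimage given as a sigma type for each point can be projected to a function [X] without an
     axiom of choice. *)
  enough (H : forall y t, {x | 0 < t -> y_coord u x t = y}).
  { exists (fun y t => proj1_sig (H y t)). intros y t.
    exact (proj2_sig (H y t)). }
  (* At nonpositive times 0 is a dummy value. *)
  intros y t. destruct (Rlt_dec 0 t) as [Ht|Ht]; [|now exists 0].
  assert (Hcont : continuity (fun z => y_coord u z t)).
  { intros z. apply continuity_pt_filterlim.
    apply (ex_derive_continuous (fun z => y_coord u z t)).
    eexists. now apply is_derive_y_coord_x. }
  assert (Hinc : forall a b, a <= b -> b - a <= y_coord u b t - y_coord u a t).
  { intros a b Hab.
    destruct (MVT_gen (fun z => y_coord u z t) a b (fun z => slope u z t))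
      as [c [_ Hc]].
    - intros z _. now apply is_derive_y_coord_x.
    - intros z _. apply Hcont.
    - rewrite Hc. rewrite <- (Rmult_1_l (b - a)) at 1.
      apply Rmult_le_compat_r; [lra|apply slope_ge_1]. }
  (* Since y grows at least at unit rate, moving from 0 by the distance between the target and the
     value at 0 brackets the target on [-r, r]. *)
  set (r := Rabs (y - y_coord u 0 t)).
  assert (Hr : 0 <= r) by apply Rabs_pos.
  assert (Hr1 : y - y_coord u 0 t <= r) by apply Rle_abs.
  assert (Hr2 : - (y - y_coord u 0 t) <= r)
    by (unfold r; rewrite <- Rabs_Ropp; apply Rle_abs).
  assert (H1 := Hinc (- r) 0 ltac:(lra)).
  assert (H2 := Hinc 0 r ltac:(lra)).
  destruct (IVT_gen (fun z => y_coord u z t) (- r) r y Hcont) as [x [_ Hx]].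
  - rewrite Rmin_left, Rmax_right; lra.
  - exists x. intros _. exact Hx.
Qed.

(** Implicit differentiation: X_t = - y_t / y_x = s cos u / s. *)
Lemma is_derive_level_t (u X : R -> R -> R) (y t : R) :
  sufficiently_smooth u -> sufficient_decay u -> gen_sine_Gordon u -> 0 < t ->
  (forall y t, 0 < t -> y_coord u (X y t) t = y) ->
  is_derive (fun s => X y s) t (cos (u (X y t) t)).
Proof.
  intros hs hd hu Ht HX.
  assert (Hs := slope_ge_1 u (X y t) t).
  replace (cos (u (X y t) t))
    with (- (- (slope u (X y t) t * cos (u (X y t) t))) / slope u (X y t) t)
    by (field; lra).
  apply (implicit_is_derive (y_coord u) (fun s => X y s)).
  - apply half_plane_differentiable; [exact Ht| | |].
    + intros z s Hs'. now apply is_derive_y_coord_x.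
    + now apply is_derive_y_coord_t.
    + apply continuity_2d_slope. apply hs, Ht.
  - lra.
  - generalize (locally_gt_0 t Ht). apply filter_imp.
    intros s Hs' x x'. now apply y_coord_expanding.
  - generalize (locally_gt_0 t Ht). apply filter_imp.
    intros s Hs'. now rewrite !HX.
Qed.

Lemma is_derive_level_x (u X : R -> R -> R) (y t : R) :
  sufficiently_smooth u -> sufficient_decay u -> 0 < t ->
  (forall y t, 0 < t -> y_coord u (X y t) t = y) ->
  is_derive (fun z => X z t) y (/ slope u (X y t) t).
Proof.
  intros hs hd Ht HX.
  assert (Hs := slope_ge_1 u (X y t) t).
  replace (/ slope u (X y t) t) with (- (-1) / slope u (X y t) t)
    by (field; lra).
  (* With the time frozen, the target value [z] takes the role of the parameter: [X] is the zero
     level of y - z, whose partial derivatives are s and -1. *)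
  apply (implicit_is_derive (fun x z => y_coord u x t - z) (fun z => X z t)).
  - apply filterdiff_differentiable_pt_lim.
    apply (is_derive_filterdiff (fun x z => y_coord u x t - z) _ _
             (fun x _ => slope u x t) (-1)).
    + apply filter_forall. intros [x z]; simpl.
      replace (slope u x t) with (minus (slope u x t) 0)
        by (unfold minus, plus, opp; simpl; ring).
      apply (is_derive_minus (fun w => y_coord u w t) (fun _ => z)).
      * now apply is_derive_y_coord_x.
      * apply (is_derive_const (V := R_NormedModule)).
    + auto_derive; [easy|ring].
    + apply (continuous_comp fst (fun x => slope u x t)).
      * apply continuous_fst.
      * apply continuous_slice_x, continuity_2d_slope, hs, Ht.
  - lra.
  - apply filter_forall. intros z x x'.
    replace (y_coord u x t - z - (y_coord u x' t - z))
      with (y_coord u x t - y_coord u x' t) by ring.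
    now apply y_coord_expanding.
  - apply filter_forall. intros z. rewrite !HX by assumption. ring.
Qed.

(** * The phase Q in the new variables and the sine-Gordon equation *)

Lemma is_derive_phase_along_level (u X : R -> R -> R) (y t : R) :
  sufficiently_smooth u -> sufficient_decay u -> gen_sine_Gordon u -> 0 < t ->
  (forall y t, 0 < t -> y_coord u (X y t) t = y) ->
  is_derive (fun s => - u (X y s) s - atan (dx u (X y s) s)) t
    (- dt u (X y t) t - sin (u (X y t) t)
     - dx u (X y t) t * cos (u (X y t) t)).
Proof.
  intros hs hd hu Ht HX.
  set (x := X y t).
  assert (Hs := slope_ge_1 u x t). assert (Hs2 := slope_sqr u x t).
  assert (Hpt := dt_dx_eq u x t hs hu Ht).
  assert (HXt := is_derive_level_t u X y t hs hd hu Ht HX). fold x in HXt.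
  destruct hs as [(h1 & h2 & h3 & h4 & h5) (c1 & c2 & c3 & c4 & c5 & c6)].
  assert (Hdu : is_derive (fun s => u (X y s) s) t
            (dx u x t * cos (u x t) + dt u x t * 1)).
  { apply is_derive_Reals.
    apply (derivable_pt_lim_comp_2d u (fun s => X y s) (fun s => s)).
    - fold x. apply half_plane_differentiable; [exact Ht| | |now apply c2].
      + intros z s Hs'. apply Derive_correct, (h1 z s Hs').
      + apply Derive_correct, (h2 x t Ht).
    - apply is_derive_Reals, HXt.
    - apply derivable_pt_lim_id. }
  (* Along the curve p changes at rate p_x cos u + p_t = s^2 sin u; the derivative 1 / (1 + p^2) of
     atan then reduces this to sin u. *)
  assert (Hdp : is_derive (fun s => dx u (X y s) s) t
            (dx (dx u) x t * cos (u x t) + dt (dx u) x t * 1)).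
  { apply is_derive_Reals.
    apply (derivable_pt_lim_comp_2d (dx u) (fun s => X y s) (fun s => s)).
    - fold x. apply half_plane_differentiable; [exact Ht| | |now apply c4].
      + intros z s Hs'. apply Derive_correct, (h3 z s Hs').
      + apply Derive_correct, (h5 x t Ht).
    - apply is_derive_Reals, HXt.
    - apply derivable_pt_lim_id. }
  assert (Hda := is_derive_comp atan _ _ _ _ (is_derive_atan _) Hdp).
  assert (Hsum := is_derive_minus _ _ _ _ _ (is_derive_opp _ _ _ Hdu) Hda).
  eapply is_derive_ext; [|match type of Hsum with is_derive _ _ ?v =>
    replace (_ - _ - _) with v; [exact Hsum|] end].
  - intros s. reflexivity.
  - fold x. rewrite Hpt, Rsqr_pow2, <- Hs2.
    unfold minus, plus, opp, scal; simpl; unfold mult; simpl.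
    field. lra.
Qed.

(** The addition formula with sin (atan p) = p / s and cos (atan p) = 1 / s. The factor 1 / s stands
    in front to match the chain rule factor X_y. *)
Lemma sin_phase (u : R -> R -> R) (x t : R) :
  sin (- u x t - atan (dx u x t))
  = / slope u x t * (- sin (u x t) - dx u x t * cos (u x t)).
Proof.
  assert (Hs := slope_ge_1 u x t).
  replace (- u x t - atan (dx u x t)) with (- (u x t + atan (dx u x t)))
    by ring.
  rewrite sin_neg, sin_plus, sin_atan, cos_atan, Rsqr_pow2.
  fold (slope u x t). field. lra.
Qed.

Theorem proposition5p1 (u : R -> R -> R)
  (hsmooth : sufficiently_smooth u)
  (hdecay : sufficient_decay u)
  (hu : gen_sine_Gordon u) :
  (forall y tau, 0 < tau -> exists! x, y_coord u x tau = y) /\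
  (forall Q : R -> R -> R,
     (forall x t, 0 < t ->
        Q (y_coord u x t) t
        = - u x t - asin (dx u x t / sqrt (1 + (dx u x t) ^ 2))) ->
     sine_Gordon Q).
Proof.
  destruct (y_coord_inverse u hsmooth hdecay) as [X HX].
  split.
  { intros y t Ht. exists (X y t). split; [now apply HX|].
    intros x' Hx'.
    assert (H := y_coord_expanding u (X y t) x' t hsmooth hdecay Ht).
    rewrite HX, Hx', Rminus_diag, Rabs_R0 in H by assumption.
    apply Rminus_diag_uniq. apply Rabs_eq_0.
    apply Rle_antisym; [exact H|apply Rabs_pos]. }
  intros Q HQ.
  assert (HQX : forall y t, 0 < t ->
            Q y t = - u (X y t) t - atan (dx u (X y t) t)).
  { intros y t Ht. rewrite <- (HX y t Ht) at 1.
    now rewrite HQ, asin_slope. }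
  (* Q_t expressed in the old variables, so that its y-derivative is G_x X_y. *)
  set (G := fun x t => - dt u x t - sin (u x t) - dx u x t * cos (u x t)).
  assert (HQt : forall y t, 0 < t -> is_derive (fun s => Q y s) t (G (X y t) t)).
  { intros y t Ht.
    (* The formula for [Q] holds only at positive times, hence the local form of extensionality. *)
    apply (is_derive_ext_loc
             (fun s => - u (X y s) s - atan (dx u (X y s) s))).
    - generalize (locally_gt_0 t Ht). apply filter_imp.
      intros s Hs. now rewrite HQX.
    - now apply is_derive_phase_along_level. }
  assert (HQty : forall y t, 0 < t ->
            is_derive (fun z => dt Q z t) y (sin (Q y t))).
  { intros y t Ht.
    apply (is_derive_ext (fun z => G (X z t) t)).
    { intros z. symmetry. apply is_derive_unique. now apply HQt. }
    rewrite HQX, sin_phase by assumption.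
    apply (is_derive_comp (fun x => G x t) (fun z => X z t)).
    2:{ now apply is_derive_level_x. }
    generalize (X y t); intros x.
    (* Substituting u_tx = (1 + p^2) sin u - p_x cos u into G_x = - u_tx - p cos u - p_x cos u + p^2
       sin u leaves - sin u - p cos u. *)
    assert (Hpt := dt_dx_eq u x t hsmooth hu Ht).
    rewrite dt_dx_comm, slope_sqr in Hpt by assumption.
    destruct hsmooth as [(h1 & h2 & h3 & h4 & h5) _].
    unfold G. auto_derive.
    - repeat split; [apply (h4 x t Ht)|apply (h1 x t Ht)|apply (h3 x t Ht)
                    |apply (h1 x t Ht)].
    - change (Derive (fun x0 => dt u x0 t) x) with (dx (dt u) x t).
      change (Derive (fun x0 => dx u x0 t) x) with (dx (dx u) x t).
      change (Derive (fun x0 => u x0 t) x) with (dx u x t).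
      rewrite Hpt. ring. }
  repeat split.
  - intros y t Ht. eexists. now apply HQt.
  - intros y t Ht. eexists. now apply HQty.
  - intros y t Ht. now apply is_derive_unique, HQty.
Qed.
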